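(* The logic $\mathsf{C2.F}$ is sound and weakly complete with respect to linear order frames: for every $p\in\mathcal{L}_>$, $\vdash_{\mathsf{C2.F}}p$ if and only if $p$ is true at every world of every order model based on a linear order frame.
   Context: Language. Let $At=\{p_0,p_1,\ldots\}$ be a countably infinite set of atoms. $\mathcal{L}_>$ is generated by $p ::= p_k\in At\mid \neg p\mid (p\wedge p)\mid (p>p)$; $\vee,\to,\leftrightarrow$ are defined as usual. Logics. $\mathsf{C2}$ is the smallest set of $\mathcal{L}_>$-sentences containing all instances of: (PC) every (substitution instance of a) theorem of classical propositional logic; (Identity) $p>p$; (Reciprocity) $(p>q)\wedge(q>p)\wedge(p>r)\to(q>r)$; (MP) $(p>q)\to(p\to q)$; (CEM) $(p>q)\vee(p>\neg q)$; and closed under (Detachment) from $\vdash p\to q$ and $\vdash p$ infer $\vdash q$; (Normality) from $\vdash(p\wedge q)\to r$ infer $\vdash((s>p)\wedge(s>q))\to(s>r)$. $\mathsf{C2.F}$ is the smallest extension of $\mathsf{C2}$ containing every instance of (Flattening) $(p>((p\wedge q)>r))\leftrightarrow((p\wedge q)>r)$ and closed under Detachment and Normality. $\vdash_{\mathsf{C2.F}}p$ means $p\in\mathsf{C2.F}$. Order frames and models. An order frame is a pair $\langle W,<\rangle$ where $W\neq\varnothing$ and $<$ is a function taking each $w\in W$ to a strict well-order $<_w$ on some subset of $W$ such that whenever $x<_w y$, either $w=x$ or $w<_w x$. Its accessibility relation is $R(w)=\{w\}\cup\{v: w<_w v\}$. An order model $\langle W,<,V\rangle$ adds a valuation $V:At\times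 W\to\{0,1\}$; put $V(p_k)=\{w:V(p_k,w)=1\}$. Denotations: $[\![p_k]\!]=V(p_k)$, $[\![\neg p]\!]=W\setminus[\![p]\!]$, $[\![p\wedge q]\!]=[\![p]\!]\cap[\![q]\!]$, and $w\in[\![p>q]\!]$ iff either $R(w)\cap[\![p]\!]=\varnothing$, or there is $y\in R(w)\cap[\![p]\!]\cap[\![q]\!]$ such that $x\notin[\![p]\!]$ whenever $x<_w y$. A sentence $p$ is true at $w$ iff $w\in[\![p]\!]$. An order frame $\langle W,<\rangle$ is linear iff there is a strict partial order $\prec$ on $W$ such that for all $w,x,y\in W$: $x<_w y$ iff $w\preceq x\prec y$ (where $w\preceq x$ means $w\prec x$ or $w=x$). *)

(* Defs.v *)
From Stdlib Require Import RelationClasses.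

Inductive form : Type :=
| Atom (k : nat)
| Neg (p : form)
| And (p q : form)
| Cond (p q : form).

Definition Or (p q : form) : form := Neg (And (Neg p) (Neg q)).
Definition Imp (p q : form) : form := Neg (And p (Neg q)).
Definition Iff (p q : form) : form := And (Imp p q) (Imp q p).

Declare Scope form_scope.
Delimit Scope form_scope with form.
Bind Scope form_scope with form.

Notation "¬ p" := (Neg p) (at level 75, right associativity) : form_scope.
Notation "p ∧ q" := (And p q) (at level 80, right associativity) : form_scope.
Notation "p ∨ q" := (Or p q) (at level 85, right associativity) : form_scope.
Notation "p → q" := (Imp p q)
  (at level 99, q at level 200, right associativity) : form_scope.
Notation "p ↔ q" := (Iff p q) (at level 95, no associativity) : form_scope.
Notation "p ▷ q" := (Cond p q) (at level 70, no associativity) : form_scope.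

Inductive pform : Type :=
| PVar (k : nat)
| PNeg (a : pform)
| PAnd (a b : pform).

Fixpoint peval (v : nat -> bool) (a : pform) : bool :=
  match a with
  | PVar k => v k
  | PNeg a => negb (peval v a)
  | PAnd a b => andb (peval v a) (peval v b)
  end.

(* Theoremhood in classical propositional logic is read as two-valued validity. *)
Definition tautology (a : pform) : Prop := forall v, peval v a = true.

Fixpoint psubst (s : nat -> form) (a : pform) : form :=
  match a with
  | PVar k => s k
  | PNeg a => Neg (psubst s a)
  | PAnd a b => And (psubst s a) (psubst s b)
  end.

Inductive C2 : form -> Prop :=
| C2_PC (a : pform) (s : nat -> form) :
    tautology a -> C2 (psubst s a)
| C2_Identity (p : form) :
    C2 (p ▷ p)
| C2_Reciprocity (p q r : form) :
    C2 (((p ▷ q) ∧ (q ▷ p) ∧ (p ▷ r)) → (q ▷ r))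
| C2_MP (p q : form) :
    C2 ((p ▷ q) → (p → q))
| C2_CEM (p q : form) :
    C2 ((p ▷ q) ∨ (p ▷ (¬ q)))
| C2_Detachment (p q : form) :
    C2 (p → q) -> C2 p -> C2 q
| C2_Normality (p q r s : form) :
    C2 ((p ∧ q) → r) -> C2 (((s ▷ p) ∧ (s ▷ q)) → (s ▷ r)).

Inductive C2F : form -> Prop :=
| C2F_C2 (p : form) :
    C2 p -> C2F p
| C2F_Flattening (p q r : form) :
    C2F ((p ▷ ((p ∧ q) ▷ r)) ↔ ((p ∧ q) ▷ r))
| C2F_Detachment (p q : form) :
    C2F (p → q) -> C2F p -> C2F q
| C2F_Normality (p q r s : form) :
    C2F ((p ∧ q) → r) -> C2F (((s ▷ p) ∧ (s ▷ q)) → (s ▷ r)).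

Record strict_well_order_on {W : Type} (D : W -> Prop) (lt : W -> W -> Prop)
    : Prop := {
  swo_field : forall x y, lt x y -> D x /\ D y;
  swo_strict : StrictOrder lt;
  swo_total : forall x y, D x -> D y -> lt x y \/ x = y \/ lt y x;
  swo_least : forall S : W -> Prop,
    (forall x, S x -> D x) -> (exists x, S x) ->
    exists m, S m /\ forall x, S x -> m = x \/ lt m x
}.

(** [before w x y] is [x <_w y]. *)
Record order_frame : Type := {
  world :> Type;
  before : world -> world -> world -> Prop;
  world_nonempty : inhabited world;
  before_well_order : forall w, exists D, strict_well_order_on D (before w);
  before_base : forall w x y, before w x y -> w = x \/ before w w x
}.

Arguments before {_} w x y.

Definition access {F : order_frame} (w v : F) : Prop :=
  v = w \/ before w w v.

Record order_model : Type := {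
  frame :> order_frame;
  valuation : nat -> frame -> bool
}.

Fixpoint denot (M : order_model) (p : form) : M -> Prop :=
  match p with
  | Atom k => fun w => valuation M k w = true
  | Neg p => fun w => ~ denot M p w
  | And p q => fun w => denot M p w /\ denot M q w
  | Cond p q => fun w =>
      (forall v, access w v -> ~ denot M p v) \/
      (exists y, access w y /\ denot M p y /\ denot M q y /\
                 forall x, before w x y -> ~ denot M p x)
  end.

Definition true_at (M : order_model) (w : M) (p : form) : Prop := denot M p w.

Definition linear (F : order_frame) : Prop :=
  exists prec : F -> F -> Prop,
    StrictOrder prec /\
    forall w x y : F, before w x y <-> (prec w x \/ w = x) /\ prec x y.

(* Main.v *)
(** Soundness: in a linear frame the nearest (p and q)-world seen from [w] is also the nearest
    one seen from the nearest p-world.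

    Completeness: for a complete theory [w] containing C2.F, the formulas [q] with
    [p > q] in [w] form a complete theory [sel p w], that of the nearest p-world. Fix a finite set
    of formulas; a world's type is the set of those that it contains. From [w], build a
    transfinite chain of theories: after a world of type [t] comes [sel (not t)], and at a limit
    comes [sel (none of T)], where [T] is the set of types recurring cofinally below the limit.
    Flattening makes every conditional whose antecedent fails throughout a stretch pass unchanged
    to the theory following it, so the truth conditions hold along the chain, provided that
    it stops only when the next theory is inconsistent. It does stop, because a
    limit of limits recurs through strictly more types than the limits below it, so no limit of
    rank [omega^k] can be passed once [k] reaches the number of types. *)

From Stdlib Require Import Arith Cantor List Lia Classical ClassicalEpsilon RelationClasses.
Require Import Defs.
Import ListNotations.

(** * Nearest worlds and soundness *)

Definition first {F : order_frame} (w : F) (P : F -> Prop) (y : F) : Prop :=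
  access w y /\ P y /\ forall x, before w x y -> ~ P x.

Lemma before_irrefl (F : order_frame) (w x : F) : ~ before w x x.
Proof.
  destruct (before_well_order F w) as [D [_ [Hirr _] _ _]]. apply Hirr.
Qed.

Lemma before_trans (F : order_frame) (w x y z : F) :
  before w x y -> before w y z -> before w x z.
Proof.
  destruct (before_well_order F w) as [D [_ [_ Htr] _ _]]. apply Htr.
Qed.

Lemma before_access (F : order_frame) (w x y : F) : before w x y -> access w x.
Proof.
  intros H. destruct (before_base F w x y H); [left; auto | right; auto].
Qed.

Lemma before_total (F : order_frame) (w x y : F) :
  access w x -> access w y -> before w x y \/ x = y \/ before w y x.
Proof.
  destruct (before_well_order F w) as [D [Hf _ Htot _]].
  intros [->|Hx] [->|Hy]; auto.
  apply Htot; [apply (Hf _ _ Hx) | apply (Hf _ _ Hy)].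
Qed.

(** If [P] holds at [w], then [w] is nearest, as nothing precedes it. Otherwise take the least
    [P]-world after [w]. The cases are split because [w] may lie outside the field of its own
    order. *)
Lemma first_exists (F : order_frame) (w : F) (P : F -> Prop) :
  (exists v, access w v /\ P v) -> exists y, first w P y.
Proof.
  intros [v [Hv HPv]].
  destruct (classic (P w)) as [Hw|Hw].
  - exists w. split; [left; reflexivity|]. split; [exact Hw|].
    intros x Hx _. destruct (before_base F w x w Hx) as [<-|Hwx].
    + exact (before_irrefl F w w Hx).
    + exact (before_irrefl F w w (before_trans F w w x w Hwx Hx)).
  - destruct (before_well_order F w) as [D [Hf _ _ Hleast]].
    destruct (Hleast (fun u => before w w u /\ P u)) as [m [[Hm HPm] Hmin]].
    + intros x [Hx _]. apply (Hf _ _ Hx).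
    + exists v. destruct Hv as [->|Hv]; [contradiction | auto].
    + exists m. split; [right; exact Hm|]. split; [exact HPm|].
      intros x Hx HPx. destruct (before_base F w x m Hx) as [<-|Hwx]; [auto|].
      destruct (Hmin x (conj Hwx HPx)) as [->|Hmx].
      * exact (before_irrefl F w x Hx).
      * exact (before_irrefl F w m (before_trans F w m x m Hmx Hx)).
Qed.

Lemma first_unique (F : order_frame) (w : F) (P : F -> Prop) (y z : F) :
  first w P y -> first w P z -> y = z.
Proof.
  intros [Ay [Py Hy]] [Az [Pz Hz]].
  destruct (before_total F w y z Ay Az) as [H|[H|H]]; auto.
  - destruct (Hz y H Py).
  - destruct (Hy z H Pz).
Qed.

(** A nearest [p]-world is unique and exists as soon as some [p]-world is accessible, so the
    disjunctive clause becomes one universal statement. *)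
Lemma denot_Cond (M : order_model) (p q : form) (w : M) :
  denot M (p ▷ q) w <-> forall y, first w (denot M p) y -> denot M q y.
Proof.
  simpl; split.
  - intros [H|[y [Ay [Py [Qy Hy]]]]] z Hz.
    + destruct Hz as [Az [Pz _]]. destruct (H z Az Pz).
    + replace z with y; [exact Qy|].
      apply (first_unique M w (denot M p)); [|exact Hz].
      split; [exact Ay | split; [exact Py | exact Hy]].
  - intros H. destruct (classic (exists v, access w v /\ denot M p v)) as [Hex|Hno].
    + right. destruct (first_exists M w _ Hex) as [y Hy].
      exists y. specialize (H y Hy). destruct Hy as [? [? ?]]. auto.
    + left. intros v Av Pv. apply Hno. eauto.
Qed.

Lemma denot_Imp (M : order_model) (p q : form) (w : M) :
  denot M (p → q) w <-> (denot M p w -> denot M q w).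
Proof. simpl. destruct (classic (denot M q w)); tauto. Qed.

Lemma denot_Or (M : order_model) (p q : form) (w : M) :
  denot M (p ∨ q) w <-> (denot M p w \/ denot M q w).
Proof. simpl. tauto. Qed.

Definition holds (P : Prop) : bool :=
  if excluded_middle_informative P then true else false.

Lemma holds_true (P : Prop) : holds P = true <-> P.
Proof. unfold holds. destruct (excluded_middle_informative P); split; auto; discriminate. Qed.

Lemma denot_psubst (M : order_model) (s : nat -> form) (a : pform) (w : M) :
  denot M (psubst s a) w <-> peval (fun k => holds (denot M (s k) w)) a = true.
Proof.
  induction a as [k|a IH|a IHa b IHb]; simpl.
  - symmetry. apply holds_true.
  - rewrite IH. destruct (peval _ a); simpl; split; auto; try discriminate; tauto.
  - rewrite IHa, IHb. symmetry. apply Bool.andb_true_iff.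
Qed.

Lemma normality_sound (M : order_model) (p q r s : form) (w : M) :
  (forall v : M, denot M ((p ∧ q) → r) v) ->
  denot M (((s ▷ p) ∧ (s ▷ q)) → (s ▷ r)) w.
Proof.
  intros H. apply denot_Imp. intros [Hp Hq].
  rewrite denot_Cond in Hp, Hq |- *. intros y Hy.
  specialize (H y). rewrite denot_Imp in H. apply H. split; auto.
Qed.

Lemma C2_sound (p : form) : C2 p -> forall (M : order_model) (w : M), denot M p w.
Proof.
  induction 1 as [a s Ha|p|p q r|p q|p q|p q _ IH1 _ IH2|p q r s _ IH]; intros M w.
  - apply denot_psubst. apply Ha.
  - apply denot_Cond. intros y Hy. apply Hy.
  - apply denot_Imp. intros [Hpq [Hqp Hpr]].
    rewrite denot_Cond in Hpq, Hqp, Hpr |- *. intros y Hy.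
    (* The nearest [q]-world [y] is a [p]-world and the nearest [p]-world [z] is a [q]-world;
       neither can precede the other, so they coincide. *)
    pose proof (Hqp y Hy) as Py. destruct Hy as [Ay [Qy My]].
    destruct (first_exists M w (denot M p)) as [z Hz]; [eauto|].
    pose proof (Hpq z Hz) as Qz.
    replace y with z; [auto|].
    destruct Hz as [Az [Pz Mz]].
    destruct (before_total M w z y Az Ay) as [H|[H|H]]; auto.
    + destruct (My z H Qz).
    + destruct (Mz y H Py).
  - apply denot_Imp. intros H. apply denot_Imp. intros Pw.
    rewrite denot_Cond in H. apply H. split; [left; reflexivity|]. split; [exact Pw|].
    intros x Hx _. destruct (before_base M w x w Hx) as [<-|Hwx].
    + exact (before_irrefl M w w Hx).
    + exact (before_irrefl M w w (before_trans M w w x w Hwx Hx)).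
  - apply denot_Or. rewrite !denot_Cond.
    destruct (classic (exists y, first w (denot M p) y /\ denot M q y)) as [[y [Hy Qy]]|H].
    + left. intros z Hz. rewrite (first_unique M w _ z y Hz Hy). exact Qy.
    + right. intros z Hz Qz. apply H. eauto.
  - specialize (IH1 M w). rewrite denot_Imp in IH1. auto.
  - apply normality_sound. intros v. apply IH.
Qed.

Lemma flattening_sound (M : order_model) (p q r : form) (w : M) :
  linear M -> denot M ((p ▷ ((p ∧ q) ▷ r)) ↔ ((p ∧ q) ▷ r)) w.
Proof.
  intros [prec [[Hirr Htr] Hlin]].
  assert (Hacc : forall u v : M, access u v <-> prec u v \/ u = v).
  { intros u v. unfold access. rewrite Hlin. intuition. }
  assert (Htrans : forall u v x : M, access u v -> access v x -> access u x).
  { intros u v x. rewrite !Hacc. intros [H|<-] [K|<-]; eauto. }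
  assert (Hfirst : forall y, first w (denot M p) y -> forall z,
            first y (denot M (p ∧ q)) z <-> first w (denot M (p ∧ q)) z).
  { intros y [Ay [Py My]] z. split; intros [Az [[Pz Qz] Mz]].
    - split; [eauto|]. split; [split; auto|].
      intros x Hx [Px Qx]. pose proof (before_access _ _ _ _ Hx) as Ax.
      (* A rival [x] of [z] that precedes [y] contradicts the choice of [y]; any other is seen from
         [y] before [z], by linearity, against the choice of [z]. *)
      destruct (before_total M w x y Ax Ay) as [H|[H|H]].
      + exact (My x H Px).
      + apply (Mz x); [|split; auto]. apply Hlin. apply Hlin in Hx. subst. tauto.
      + apply (Mz x); [|split; auto]. apply Hlin. apply Hlin in Hx, H. tauto.
    - split.
      + destruct (before_total M w y z Ay Az) as [H|[H|H]].
        * apply Hacc. apply Hlin in H. tauto.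
        * left. auto.
        * destruct (My z H Pz).
      + split; [split; auto|]. intros x Hx. apply Mz.
        apply Hlin. apply Hlin in Hx. rewrite <- Hacc in *. split; [|tauto].
        apply Htrans with y; tauto. }
  assert (H : denot M (p ▷ ((p ∧ q) ▷ r)) w <-> denot M ((p ∧ q) ▷ r) w).
  { rewrite !denot_Cond. setoid_rewrite denot_Cond. split.
    - intros H z Hz. destruct (first_exists M w (denot M p)) as [y Hy].
      { destruct Hz as [Az [[Pz _] _]]. eauto. }
      apply (H y Hy). apply Hfirst; auto.
    - intros H y Hy z Hz. apply H. apply (Hfirst y Hy). exact Hz. }
  split; apply denot_Imp; tauto.
Qed.

Lemma C2F_sound (p : form) :
  C2F p -> forall M : order_model, linear M -> forall w : M, denot M p w.
Proof.
  induction 1 as [p Hp|p q r|p q _ IH1 _ IH2|p q r s _ IH]; intros M HM w.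
  - apply C2_sound. exact Hp.
  - apply flattening_sound. exact HM.
  - specialize (IH1 M HM w). rewrite denot_Imp in IH1. auto.
  - apply normality_sound. intros v. apply IH. exact HM.
Qed.

(** * Propositional reasoning in C2.F *)

(** Shaped like [Imp], so that [psubst] maps it to [Imp] by computation. *)
Definition pimp (a b : pform) : pform := PNeg (PAnd a (PNeg b)).

Definition subst3 (p q r : form) (n : nat) : form :=
  match n with 0 => p | 1 => q | _ => r end.

Lemma C2F_taut (a : pform) (p q r : form) :
  (forall v, peval v a = true) -> C2F (psubst (subst3 p q r) a).
Proof. intros H. exact (C2F_C2 _ (C2_PC a _ H)). Qed.

Ltac taut a p q r :=
  refine (C2F_taut a p q r _); let v := fresh in
  intros v; simpl; destruct (v 0), (v 1), (v 2); reflexivity.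

Local Notation X := (PVar 0).
Local Notation Y := (PVar 1).
Local Notation Z := (PVar 2).

Lemma taut_K (p q : form) : C2F (p → (q → p)).
Proof. taut (pimp X (pimp Y X)) p q q. Qed.

Lemma taut_S (p q r : form) : C2F ((p → (q → r)) → ((p → q) → (p → r))).
Proof. taut (pimp (pimp X (pimp Y Z)) (pimp (pimp X Y) (pimp X Z))) p q r. Qed.

Lemma taut_exfalso (p q : form) : C2F (p → ((¬ p) → q)).
Proof. taut (pimp X (pimp (PNeg X) Y)) p q q. Qed.

Lemma taut_conj (p q : form) : C2F (p → (q → (p ∧ q))).
Proof. taut (pimp X (pimp Y (PAnd X Y))) p q q. Qed.

Lemma taut_fst (p q : form) : C2F ((p ∧ q) → p).
Proof. taut (pimp (PAnd X Y) X) p q q. Qed.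

Lemma taut_snd (p q : form) : C2F ((p ∧ q) → q).
Proof. taut (pimp (PAnd X Y) Y) p q q. Qed.

Lemma taut_or_l (p q : form) : C2F ((p ∨ q) → ((¬ p) → q)).
Proof. taut (pimp (PNeg (PAnd (PNeg X) (PNeg Y))) (pimp (PNeg X) Y)) p q q. Qed.

Lemma taut_dne (p : form) : C2F ((¬ ¬ p) → p).
Proof. taut (pimp (PNeg (PNeg X)) X) p p p. Qed.

Lemma taut_contra (p q : form) : C2F ((p → q) → ((p → ¬ q) → ¬ p)).
Proof. taut (pimp (pimp X Y) (pimp (pimp X (PNeg Y)) (PNeg X))) p q q. Qed.

Lemma taut_cases (p q : form) : C2F ((¬ (p ∧ q)) → ((¬ (p ∧ ¬ q)) → ¬ p)).
Proof. taut (pimp (PNeg (PAnd X Y)) (pimp (PNeg (PAnd X (PNeg Y))) (PNeg X))) p q q. Qed.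

Lemma C2F_mp2 (p q r : form) : C2F (p → (q → r)) -> C2F p -> C2F q -> C2F r.
Proof. intros H Hp Hq. exact (C2F_Detachment _ _ (C2F_Detachment _ _ H Hp) Hq). Qed.

Lemma C2F_weaken (p q : form) : C2F q -> C2F (p → q).
Proof. apply C2F_Detachment, taut_K. Qed.

Lemma C2F_ap (p q r : form) : C2F (p → (q → r)) -> C2F (p → q) -> C2F (p → r).
Proof. intros H1 H2. exact (C2F_mp2 _ _ _ (taut_S p q r) H1 H2). Qed.

Lemma C2F_trans (p q r : form) : C2F (p → q) -> C2F (q → r) -> C2F (p → r).
Proof. intros H1 H2. apply C2F_ap with q; [apply C2F_weaken; exact H2 | exact H1]. Qed.

Lemma C2F_refl (p : form) : C2F (p → p).
Proof. taut (pimp X X) p p p. Qed.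

(** * Complete theories and the Lindenbaum construction *)

(** The set of all formulas counts as a complete theory: it encodes the absence of a world. *)
Record complete (w : form -> Prop) : Prop := {
  complete_thm : forall p, C2F p -> w p;
  complete_mp : forall p q, w (p → q)%form -> w p -> w q;
  complete_em : forall p, w p \/ w (¬ p)%form
}.

Definition proper (w : form -> Prop) : Prop := exists p, ~ w p.

Definition maximal (w : form -> Prop) : Prop := complete w /\ proper w.

Lemma improper_all (w : form -> Prop) (p : form) : ~ proper w -> w p.
Proof. intros H. apply NNPP. intros Hp. apply H. exists p. exact Hp. Qed.

Lemma complete_thm2 (w : form -> Prop) (p q r : form) :
  complete w -> C2F (p → (q → r)) -> w p -> w q -> w r.
Proof.
  intros Hw H Hp Hq. apply complete_mp with q; auto.
  apply complete_mp with p; auto. apply complete_thm; auto.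
Qed.

Lemma complete_thm1 (w : form -> Prop) (p q : form) :
  complete w -> C2F (p → q) -> w p -> w q.
Proof. intros Hw H Hp. apply complete_mp with p; auto. apply complete_thm; auto. Qed.

Lemma complete_And (w : form -> Prop) (p q : form) :
  complete w -> (w (p ∧ q)%form <-> w p /\ w q).
Proof.
  intros Hw. split.
  - intros H. split; revert H; apply complete_thm1; auto using taut_fst, taut_snd.
  - intros [Hp Hq]. revert Hp Hq. apply complete_thm2; auto using taut_conj.
Qed.

Lemma maximal_Neg (w : form -> Prop) (p : form) :
  maximal w -> (w (¬ p)%form <-> ~ w p).
Proof.
  intros [Hw [q Hq]]. split.
  - intros Hn Hp. apply Hq. revert Hp Hn. apply complete_thm2; auto using taut_exfalso.
  - intros H. destruct (complete_em w Hw p); tauto.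
Qed.

Fixpoint code (p : form) : nat :=
  match p with
  | Atom k => Cantor.to_nat (0, k)
  | Neg p => Cantor.to_nat (1, code p)
  | And p q => Cantor.to_nat (2, Cantor.to_nat (code p, code q))
  | Cond p q => Cantor.to_nat (3, Cantor.to_nat (code p, code q))
  end.

Lemma to_nat_pair_inj (a b c d : nat) :
  Cantor.to_nat (a, b) = Cantor.to_nat (c, d) -> a = c /\ b = d.
Proof. intros H. apply Cantor.to_nat_inj, pair_equal_spec in H. exact H. Qed.

Lemma code_inj (p q : form) : code p = code q -> p = q.
Proof.
  revert q. induction p; intros [ ]; cbn [code]; intros H;
    apply to_nat_pair_inj in H; destruct H as [H0 H]; try discriminate;
    try (apply to_nat_pair_inj in H; destruct H); f_equal; auto.
Qed.

Definition decode (n : nat) : form :=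
  epsilon (inhabits (Atom 0)) (fun p => code p = n).

Lemma decode_code (p : form) : decode (code p) = p.
Proof.
  apply code_inj. unfold decode. apply epsilon_spec. exists p. reflexivity.
Qed.

(** Each stage is a single formula, since derivability has no premise set; the next stage adds
    [decode n] if that is consistent and its negation otherwise. *)
Fixpoint lindenbaum (c : form) (n : nat) : form :=
  match n with
  | 0 => c
  | S n => let d := lindenbaum c n in
           if excluded_middle_informative (C2F (¬ (d ∧ decode n))%form)
           then (d ∧ ¬ decode n)%form else (d ∧ decode n)%form
  end.

Lemma lindenbaum_consistent (c : form) (n : nat) :
  ~ C2F (¬ c)%form -> ~ C2F (¬ lindenbaum c n)%form.
Proof.
  intros Hc. induction n as [|n IH]; simpl; [exact Hc|].
  destruct (excluded_middle_informative _) as [H|H]; [|exact H].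
  intros H'. apply IH. exact (C2F_mp2 _ _ _ (taut_cases _ _) H H').
Qed.

Lemma lindenbaum_mono (c : form) (m n : nat) :
  m <= n -> C2F (lindenbaum c n → lindenbaum c m).
Proof.
  induction 1 as [|n _ IH]; [apply C2F_refl|].
  refine (C2F_trans _ _ _ _ IH). simpl.
  destruct (excluded_middle_informative _); apply taut_fst.
Qed.

Lemma lindenbaum_decides (c p : form) :
  C2F (lindenbaum c (S (code p)) → p) \/ C2F (lindenbaum c (S (code p)) → ¬ p).
Proof.
  simpl. rewrite decode_code.
  destruct (excluded_middle_informative _); [right | left]; apply taut_snd.
Qed.

Lemma maximal_extension (c : form) :
  ~ C2F (¬ c)%form -> exists w, maximal w /\ w c.
Proof.
  intros Hc. exists (fun p => exists n, C2F (lindenbaum c n → p)).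
  split; [split; [split|]|].
  - intros p Hp. exists 0. apply C2F_weaken. exact Hp.
  - intros p q [m Hm] [n Hn]. exists (max m n).
    apply C2F_ap with p.
    + apply C2F_trans with (lindenbaum c m); auto. apply lindenbaum_mono; lia.
    + apply C2F_trans with (lindenbaum c n); auto. apply lindenbaum_mono; lia.
  - intros p. destruct (lindenbaum_decides c p); eauto.
  - exists (¬ c)%form. intros [n Hn]. apply (lindenbaum_consistent c n Hc).
    refine (C2F_mp2 _ _ _ (taut_contra _ c) _ Hn). apply (lindenbaum_mono c 0); lia.
  - exists 0. apply C2F_refl.
Qed.

(** Otherwise the negation of [p] extends to a maximal theory. This lets theorems be checked at each
    maximal theory instead of derived. *)
Lemma C2F_of_maximal (p : form) : (forall w, maximal w -> w p) -> C2F p.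
Proof.
  intros H. apply NNPP. intros Hp.
  destruct (maximal_extension (¬ p)%form) as [w [Hw Hwp]].
  - intros Hn. apply Hp. exact (C2F_Detachment _ _ (taut_dne p) Hn).
  - exact (proj1 (maximal_Neg w p Hw) Hwp (H w Hw)).
Qed.

Lemma maximal_Imp (w : form -> Prop) (p q : form) :
  maximal w -> (w (p → q)%form <-> (w p -> w q)).
Proof.
  intros Hw. unfold Imp. rewrite maximal_Neg by exact Hw.
  rewrite complete_And by apply Hw. rewrite maximal_Neg by exact Hw.
  split; [|tauto]. intros H Hp. apply NNPP. tauto.
Qed.

Lemma C2F_Imp_of_maximal (p q : form) :
  (forall u, maximal u -> u p -> u q) -> C2F (p → q).
Proof. intros H. apply C2F_of_maximal. intros u Hu. exact (proj2 (maximal_Imp u p q Hu) (H u Hu)). Qed.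

(** * Theories of nearest worlds *)

(** The theory of the nearest [s]-world; improper when there is none. *)
Definition sel (s : form) (w : form -> Prop) : form -> Prop := fun q => w (s ▷ q)%form.

(** Identity and Normality bring in every theorem, Normality gives closure under modus ponens, and
    CEM decides every formula. *)
Lemma sel_complete (s : form) (w : form -> Prop) : complete w -> complete (sel s w).
Proof.
  intros Hw. unfold sel. split.
  - intros p Hp. apply (complete_thm2 w (s ▷ s ∧ s ▷ s)%form (s ▷ s)%form); auto.
    + apply C2F_trans with (s ▷ p)%form; [|apply taut_K].
      apply C2F_Normality. apply C2F_weaken. exact Hp.
    + apply complete_And; auto. split; apply complete_thm; auto; apply C2F_C2, C2_Identity.
    + apply complete_thm; auto; apply C2F_C2, C2_Identity.
  - intros p q Hpq Hp. apply (complete_thm1 w ((s ▷ (p → q)) ∧ (s ▷ p))%form); auto.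
    + apply C2F_Normality. apply C2F_Imp_of_maximal. intros u Hu Hc.
      apply complete_And in Hc; [|apply Hu]. destruct Hc as [H1 H2].
      exact (proj1 (maximal_Imp u p q Hu) H1 H2).
    + apply complete_And; auto.
  - intros p.
    assert (Hem : w ((s ▷ p) ∨ (s ▷ ¬ p))%form)
      by (apply complete_thm; auto; apply C2F_C2, C2_CEM).
    destruct (complete_em w Hw (s ▷ p)%form) as [H|H]; [auto|right].
    revert Hem H. apply complete_thm2; auto. apply taut_or_l.
Qed.

Lemma proper_of_sel (s : form) (w : form -> Prop) : proper (sel s w) -> proper w.
Proof. intros [q Hq]. exists (s ▷ q)%form. exact Hq. Qed.

Lemma sel_self (s : form) (w : form -> Prop) : complete w -> sel s w s.
Proof. intros Hw. apply (complete_thm w Hw). apply C2F_C2, C2_Identity. Qed.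

Lemma Cond_of_Imp (w : form -> Prop) (p q : form) :
  complete w -> (forall u, maximal u -> u p -> u q) -> w (p ▷ q)%form.
Proof.
  intros Hw H. apply (complete_thm1 (sel p w) p q).
  - apply sel_complete; auto.
  - apply C2F_Imp_of_maximal; auto.
  - apply sel_self; auto.
Qed.

Lemma reciprocity (w : form -> Prop) (p q r : form) :
  complete w -> w (p ▷ q)%form -> w (q ▷ p)%form -> w (p ▷ r)%form -> w (q ▷ r)%form.
Proof.
  intros Hw Hpq Hqp Hpr.
  eapply complete_thm1; [exact Hw | apply C2F_C2, (C2_Reciprocity p q r) |].
  rewrite !complete_And by exact Hw. auto.
Qed.

Lemma Cond_congr (w : form -> Prop) (p q r : form) :
  complete w -> (forall u, maximal u -> u p <-> u q) ->
  (w (p ▷ r)%form <-> w (q ▷ r)%form).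
Proof.
  intros Hw H. split; apply reciprocity; auto; apply Cond_of_Imp; firstorder.
Qed.

(** Here [p] is equivalent to [s ∧ p], so the Flattening axiom says that passing to the nearest
    [s]-world preserves every conditional whose antecedent entails [s]. *)
Lemma flatten (w : form -> Prop) (p q s : form) :
  complete w -> (forall u, maximal u -> u p -> u s) ->
  (w (p ▷ q)%form <-> sel s w (p ▷ q)%form).
Proof.
  intros Hw Hps.
  assert (Heq : forall v, complete v -> (v (p ▷ q)%form <-> v ((s ∧ p) ▷ q)%form)).
  { intros v Hv. apply Cond_congr; auto. intros u Hu.
    rewrite complete_And by apply Hu. firstorder. }
  rewrite (Heq w) by exact Hw. rewrite (Heq (sel s w)) by (apply sel_complete; exact Hw).
  pose proof (complete_thm w Hw _ (C2F_Flattening s p q)) as H.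
  apply (complete_And w _ _ Hw) in H. destruct H as [H1 H2].
  split; [exact (complete_mp w Hw _ _ H2) | exact (complete_mp w Hw _ _ H1)].
Qed.

(** One direction is MP. For the other, CEM leaves [p ▷ ¬ q] as the only alternative, and by MP this
    makes [w] inconsistent, so that it contains everything. *)
Lemma Cond_here (w : form -> Prop) (p q : form) :
  complete w -> w p -> (w (p ▷ q)%form <-> w q).
Proof.
  intros Hw Hp.
  assert (H : forall r, w (p ▷ r)%form -> w r).
  { intros r Hr. revert Hr Hp. apply complete_thm2; auto. apply C2F_C2, C2_MP. }
  split; [apply H|]. intros Hq.
  destruct (complete_em (sel p w) (sel_complete p w Hw) q) as [Hs|Hs]; [exact Hs|].
  apply improper_all. intros [r Hr]. apply Hr.
  apply H in Hs. revert Hq Hs. apply complete_thm2; auto. apply taut_exfalso.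
Qed.

(** * Types over a finite set of formulas *)

Definition top : form := (Atom 0 → Atom 0)%form.

(** The state description of [w] over [G], which serves as its type. *)
Fixpoint chi (w : form -> Prop) (G : list form) : form :=
  match G with
  | [] => top
  | s :: G => ((if holds (w s) then s else ¬ s) ∧ chi w G)%form
  end.

Fixpoint chis (G : list form) : list form :=
  match G with
  | [] => [top]
  | s :: G => map (And s) (chis G) ++ map (And (¬ s)%form) (chis G)
  end.

(** Keeps the two possible conjuncts for a formula distinct, so that types can be compared by
    syntactic equality. *)
Lemma Neg_neq (p : form) : (¬ p)%form <> p.
Proof. induction p; try discriminate. intros H. injection H. exact IHp. Qed.

Lemma in_chis (w : form -> Prop) (G : list form) : In (chi w G) (chis G).
Proof.
  induction G as [|s G IH]; simpl; [auto|].
  apply in_app_iff. destruct (holds (w s)); [left|right]; apply in_map; exact IH.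
Qed.

Lemma chi_eq (w : form -> Prop) (G : list form) (t : form) :
  maximal w -> In t (chis G) -> (w t <-> chi w G = t).
Proof.
  intros Hw. revert t. induction G as [|s G IH]; simpl; intros t Ht.
  - destruct Ht as [<-|[]]. split; [auto|]. intros _. apply complete_thm; [apply Hw|].
    apply C2F_refl.
  - apply in_app_iff in Ht.
    assert (Hs : holds (w s) = true <-> w s) by apply holds_true.
    destruct Ht as [Ht|Ht]; apply in_map_iff in Ht; destruct Ht as [t' [<- Ht]];
      rewrite (complete_And w _ _ (proj1 Hw)), (IH t' Ht);
      try rewrite (maximal_Neg w s Hw); destruct (holds (w s)); split.
    + intros [_ <-]. reflexivity.
    + intros H. injection H. tauto.
    + intros [H _]. apply Hs in H. discriminate.
    + intros H. injection H as H H'. destruct (Neg_neq s H).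
    + tauto.
    + intros H. injection H as H H'. destruct (Neg_neq s (eq_sym H)).
    + intros [_ <-]. reflexivity.
    + intros H. injection H as H'. split; [|exact H']. intros H. apply Hs in H. discriminate.
Qed.

Lemma chi_agree (u v : form -> Prop) (G : list form) (p : form) :
  chi u G = chi v G -> In p G -> u p -> v p.
Proof.
  induction G as [|s G IH]; simpl; [tauto|].
  intros H [->|Hp] Hu; injection H as H H'; [|auto].
  apply holds_true in Hu. rewrite Hu in H. apply holds_true.
  destruct (holds (v p)); [reflexivity|]. destruct (Neg_neq p (eq_sym H)).
Qed.

(** Membership in [G] would be too narrow: the formulas [none_of T] must be covered as well. *)
Definition decided (G : list form) (p : form) : Prop :=
  forall u v, maximal u -> maximal v -> chi u G = chi v G -> u p -> v p.

Definition none_of (T : list form) : form :=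
  fold_right (fun t a => (¬ t ∧ a)%form) top T.

Lemma none_of_spec (w : form -> Prop) (T : list form) :
  maximal w -> (w (none_of T) <-> forall t, In t T -> ~ w t).
Proof.
  intros Hw. induction T as [|t T IH]; simpl.
  - split; [tauto|]. intros _. apply complete_thm; [apply Hw | apply C2F_refl].
  - rewrite (complete_And w _ _ (proj1 Hw)), IH, (maximal_Neg w t Hw).
    split; [|auto]. intros [H1 H2] t' [<-|H]; auto.
Qed.

Lemma none_of_decided (G T : list form) :
  incl T (chis G) -> decided G (none_of T).
Proof.
  intros HT u v Hu Hv Huv. rewrite !none_of_spec by assumption.
  intros H t Ht Hvt. apply (H t Ht).
  rewrite chi_eq in * by auto. congruence.
Qed.

(** One failure of [p] at a world of type [t] excludes [p] from all worlds of that type. The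
    conclusion is what [flatten] needs for the antecedent [none_of T]. *)
Lemma Imp_none_of (G T : list form) (p : form) :
  decided G p ->
  (forall t, In t T -> exists x, maximal x /\ t = chi x G /\ ~ x p) ->
  forall u, maximal u -> u p -> u (none_of T).
Proof.
  intros Hp HT u Hu Hup. apply none_of_spec; [exact Hu|]. intros t Ht Hut.
  destruct (HT t Ht) as [x [Hx [-> Hxp]]]. apply Hxp.
  rewrite chi_eq in Hut by auto using in_chis. exact (Hp u x Hu Hx Hut Hup).
Qed.

Lemma none_of_not_In (G T : list form) (w : form -> Prop) :
  maximal w -> w (none_of T) -> ~ In (chi w G) T.
Proof.
  intros Hw HT Hin. apply (proj1 (none_of_spec w T Hw) HT _ Hin).
  apply (chi_eq w G); auto using in_chis.
Qed.

(** * The lexicographic order on lists of fixed length *)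

(** On lists of length [k] the order type is omega^k; such lists index a stretch of rank [k]. *)
Fixpoint lexlt (l m : list nat) : Prop :=
  match l, m with
  | i :: l, j :: m => i < j \/ i = j /\ lexlt l m
  | _, _ => False
  end.

Lemma lexlt_irrefl (l : list nat) : ~ lexlt l l.
Proof. induction l as [|i l IH]; simpl; [tauto|]. intros [H|[_ H]]; [lia|tauto]. Qed.

Lemma lexlt_trans (l m n : list nat) : lexlt l m -> lexlt m n -> lexlt l n.
Proof.
  revert m n. induction l as [|i l IH]; intros [|j m] [|k n]; simpl; try tauto.
  intros [H|[H1 H2]] [K|[K1 K2]]; try (left; lia). right. split; [lia|eauto].
Qed.

Lemma lexlt_total (l m : list nat) :
  length l = length m -> lexlt l m \/ l = m \/ lexlt m l.
Proof.
  revert m. induction l as [|i l IH]; intros [|j m]; simpl; try discriminate; auto.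
  intros H. injection H as H. destruct (lt_eq_lt_dec i j) as [[Hij|Hij]|Hij]; auto.
  subst j. destruct (IH m H) as [K|[->|K]]; auto.
Qed.

Lemma nat_least (P : nat -> Prop) :
  (exists n, P n) -> exists n, P n /\ forall m, P m -> n <= m.
Proof.
  intros [n Hn]. apply NNPP. intros H. revert Hn.
  induction n as [n IH] using lt_wf_ind. intros Hn. apply H.
  exists n. split; [exact Hn|]. intros m Hm.
  destruct (le_lt_dec n m) as [|Hlt]; [assumption|]. destruct (IH m Hlt Hm).
Qed.

Lemma lexlt_least (k : nat) (P : list nat -> Prop) :
  (forall l, P l -> length l = k) -> (exists l, P l) ->
  exists m, P m /\ forall l, P l -> m = l \/ lexlt m l.
Proof.
  revert P. induction k as [|k IH]; intros P Hk [l Hl].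
  - exists l. split; [exact Hl|]. intros m Hm. left.
    apply Hk, length_zero_iff_nil in Hl. apply Hk, length_zero_iff_nil in Hm. congruence.
  - destruct (nat_least (fun i => exists l, P (i :: l))) as [i [Hi Hmin]].
    { destruct l as [|i l]; [apply Hk in Hl; discriminate|]. eauto. }
    destruct (IH (fun l => P (i :: l))) as [m [Hm Hleast]]; [|exact Hi|].
    { intros m Hm. apply Hk in Hm. simpl in Hm. lia. }
    exists (i :: m). split; [exact Hm|].
    intros [|j n] Hn; [apply Hk in Hn; discriminate|]. simpl.
    assert (Hij : i <= j) by eauto.
    destruct (Nat.eq_dec i j) as [<-|]; [|right; left; lia].
    destruct (Hleast n Hn) as [<-|H]; auto.
Qed.

(** * Segments of the chain *)

(** A stretch of the chain of length at most [omega^k], starting with [w]; [out] is the theory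
    that has to come next, improper if the chain may stop. *)
Record segment (G : list form) (k : nat) (w : form -> Prop) (dom : list nat -> Prop)
    (lab : list nat -> form -> Prop) (out : form -> Prop) : Prop := {
  seg_length : forall l, dom l -> length l = k;
  seg_maximal : forall l, dom l -> maximal (lab l);
  seg_out : complete out;
  seg_start : proper w ->
    exists l0, dom l0 /\ lab l0 = w /\ forall l, dom l -> l0 = l \/ lexlt l0 l;
  seg_empty : ~ proper w -> (forall l, ~ dom l) /\ ~ proper out;
  seg_hit : forall l m p q, decided G p -> dom l -> dom m -> l = m \/ lexlt l m ->
    lab m p -> (forall x, dom x -> l = x \/ lexlt l x -> lexlt x m -> ~ lab x p) ->
    (lab l (p ▷ q)%form <-> lab m q);
  seg_miss : forall l p q, decided G p -> dom l ->
    (forall x, dom x -> l = x \/ lexlt l x -> ~ lab x p) ->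
    (lab l (p ▷ q)%form <-> out (p ▷ q)%form);
  (* This forces [out] to be improper once [k] reaches the number of types. *)
  seg_types : proper out ->
    exists T, NoDup T /\ k < length T /\ ~ In (chi out G) T /\
      forall t, In t T -> exists l, dom l /\ t = chi (lab l) G
}.

(** The single world [w], or none if [w] is improper, followed by the theory of the nearest world of
    another type. *)
Lemma segment_zero (G : list form) (w : form -> Prop) :
  complete w -> exists dom lab out, segment G 0 w dom lab out.
Proof.
  intros Hw. pose (s := none_of [chi w G]).
  assert (Hout : complete (sel s w)) by (apply sel_complete; exact Hw).
  exists (fun l => l = [] /\ proper w), (fun _ => w), (sel s w). split.
  - intros l [-> _]. reflexivity.
  - intros l [_ H]. split; auto.
  - exact Hout.
  - intros H. exists []. split; [auto|]. split; [reflexivity|]. intros l [-> _]. auto.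
  - intros H. split; [tauto|]. intros Hs. exact (H (proper_of_sel _ _ Hs)).
  - intros l m p q _ _ _ _ Hp _. apply Cond_here; auto.
  - intros l p q Hp [-> Hpr] Hno. apply flatten; auto.
    apply (Imp_none_of G); [exact Hp|]. intros t [<-|[]]. exists w.
    split; [split; auto|]. split; [reflexivity|]. apply (Hno []); auto.
  - intros Hpr. exists [chi w G]. split; [repeat constructor; auto|]. split; [simpl; lia|].
    split.
    + apply none_of_not_In; [split; auto|]. apply sel_self. exact Hw.
    + intros t [<-|[]]. exists []. split; [|reflexivity]. split; [reflexivity|].
      exact (proper_of_sel _ _ Hpr).
Qed.

Lemma sublist_of_pred (A : list form) (P : form -> Prop) :
  exists T, NoDup T /\ forall t, In t T <-> In t A /\ P t.
Proof.
  induction A as [|a A [T [HT HTA]]].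
  - exists []. split; [constructor|]. simpl. tauto.
  - destruct (classic (P a /\ ~ In a T)) as [[Ha HaT]|Ha].
    + exists (a :: T). split; [constructor; auto|]. intros t. simpl. rewrite HTA.
      intuition congruence.
    + exists T. split; [exact HT|]. intros t. simpl. rewrite HTA. split; [tauto|].
      intros [[<-|H] Ht]; [|tauto]. apply HTA. apply NNPP. tauto.
Qed.

Lemma eventually_all (A : list form) (P : nat -> form -> Prop) :
  (forall t, In t A -> exists m, forall i, m <= i -> P i t) ->
  exists m, forall t, In t A -> forall i, m <= i -> P i t.
Proof.
  induction A as [|a A IH]; intros H.
  - exists 0. intros t [].
  - destruct IH as [m Hm]; [intros; apply H; simpl; auto|].
    destruct (H a) as [n Hn]; [simpl; auto|].
    exists (max m n). intros t [<-|Ht] i Hi; [apply Hn | apply Hm]; auto; lia.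
Qed.

(** Omega many segments end to end: the head of an index names the segment, the tail a position in
    it. *)
Definition sum_dom (D : nat -> list nat -> Prop) (l : list nat) : Prop :=
  match l with [] => False | i :: l => D i l end.

Definition sum_lab (L : nat -> list nat -> form -> Prop) (l : list nat) : form -> Prop :=
  match l with [] => fun _ => True | i :: l => L i l end.

Lemma segment_pass G k w dom lab out p q :
  segment G k w dom lab out -> decided G p ->
  (forall x, dom x -> ~ lab x p) ->
  (w (p ▷ q)%form <-> out (p ▷ q)%form).
Proof.
  intros H Hp Hno. destruct (classic (proper w)) as [Hw|Hw].
  - destruct (seg_start _ _ _ _ _ _ H Hw) as [l0 [Hl0 [<- _]]].
    apply (seg_miss _ _ _ _ _ _ H); auto.
  - destruct (seg_empty _ _ _ _ _ _ H Hw) as [_ Ho].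
    split; intros _; apply improper_all; assumption.
Qed.

Lemma segment_enter G k w dom lab out m p q :
  segment G k w dom lab out -> decided G p -> dom m -> lab m p ->
  (forall x, dom x -> lexlt x m -> ~ lab x p) ->
  (w (p ▷ q)%form <-> lab m q).
Proof.
  intros H Hp Hm Hmp Hno. destruct (classic (proper w)) as [Hw|Hw].
  - destruct (seg_start _ _ _ _ _ _ H Hw) as [l0 [Hl0 [<- Hmin]]].
    apply (seg_hit _ _ _ _ _ _ H); auto.
  - destruct (seg_empty _ _ _ _ _ _ H Hw) as [He _]. destruct (He m Hm).
Qed.

Lemma segments_pass G k s D L i j p q :
  (forall i, segment G k (s i) (D i) (L i) (s (S i))) -> decided G p -> i <= j ->
  (forall m x, i <= m < j -> D m x -> ~ L m x p) ->
  (s i (p ▷ q)%form <-> s j (p ▷ q)%form).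
Proof.
  intros H Hp Hij. induction Hij as [|j Hij IH]; intros Hno; [tauto|].
  rewrite IH.
  - apply (segment_pass _ _ _ _ _ _ p q (H j) Hp). intros x. apply Hno. lia.
  - intros m x Hm. apply Hno. lia.
Qed.

(** Only what concerns the limit is left to the hypotheses: how conditionals pass to [out], and how
    many types occur below it. *)
Lemma segment_sum G k s D L out :
  (forall i, segment G k (s i) (D i) (L i) (s (S i))) ->
  complete out -> (~ proper (s 0) -> ~ proper out) ->
  (forall i p q, decided G p -> (forall j x, i <= j -> D j x -> ~ L j x p) ->
     (s i (p ▷ q)%form <-> out (p ▷ q)%form)) ->
  (proper out -> exists T, NoDup T /\ S k < length T /\ ~ In (chi out G) T /\
     forall t, In t T -> exists i l, D i l /\ t = chi (L i l) G) ->
  segment G (S k) (s 0) (sum_dom D) (sum_lab L) out.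
Proof.
  intros H Hout Hempty Hmiss Htypes.
  split.
  - intros [|i l] Hl; [destruct Hl|]. simpl. f_equal. apply (seg_length _ _ _ _ _ _ (H i) l Hl).
  - intros [|i l] Hl; [destruct Hl|]. apply (seg_maximal _ _ _ _ _ _ (H i) l Hl).
  - exact Hout.
  - intros Hs. destruct (seg_start _ _ _ _ _ _ (H 0) Hs) as [l0 [H1 [H2 H3]]].
    exists (0 :: l0). split; [exact H1|]. split; [exact H2|].
    intros [|[|i] l] Hl; [destruct Hl| |right; simpl; lia].
    destruct (H3 l Hl) as [<-|K]; [auto|]. right; simpl; auto.
  - intros Hs. split; [|auto].
    assert (Hi : forall i, ~ proper (s i)).
    { induction i as [|i IH]; [exact Hs|]. apply (seg_empty _ _ _ _ _ _ (H i) IH). }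
    intros [|i l] Hl; [exact Hl|]. exact (proj1 (seg_empty _ _ _ _ _ _ (H i) (Hi i)) l Hl).
  - intros [|i l] [|j m] p q Hp Hl Hm; try tauto. simpl in Hl, Hm. simpl.
    intros Hle Hmp Hno. destruct (lt_eq_lt_dec i j) as [[Hij|<-]|Hji].
    + assert (Hi : forall x, D i x -> l = x \/ lexlt l x -> ~ L i x p).
      { intros x Hx Hlx. apply (Hno (i :: x) Hx); simpl; intuition congruence. }
      (* The conditional leaves segment [i], crosses the segments strictly between, and meets its
         witness in segment [j]. *)
      rewrite (seg_miss _ _ _ _ _ _ (H i) l p q Hp Hl Hi).
      rewrite (segments_pass G k s D L (S i) j p q H Hp Hij).
      * apply (segment_enter _ _ _ _ _ _ m p q (H j) Hp Hm Hmp).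
        intros x Hx Hxm. apply (Hno (j :: x) Hx); simpl; auto.
      * intros n x Hn Hx. apply (Hno (n :: x) Hx); simpl; [right; left | left]; lia.
    + apply (seg_hit _ _ _ _ _ _ (H i)); auto.
      * destruct Hle as [K|[K|[_ K]]]; [injection K; auto | lia | auto].
      * intros x Hx Hlx Hxm. apply (Hno (i :: x) Hx); simpl; intuition congruence.
    + exfalso. destruct Hle as [K|[K|[K _]]]; [injection K; intros; lia | lia | lia].
  - intros [|i l] p q Hp Hl Hno; [destruct Hl|]. simpl in Hl. simpl.
    rewrite (seg_miss _ _ _ _ _ _ (H i) l p q Hp Hl).
    + apply Hmiss; [exact Hp|]. intros j x Hj Hx. apply (Hno (j :: x) Hx). simpl. right; left; lia.
    + intros x Hx Hlx. apply (Hno (i :: x) Hx); simpl; intuition congruence.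
  - intros Ho. destruct (Htypes Ho) as [T [HT1 [HT2 [HT3 HT4]]]].
    exists T. repeat (split; [assumption|]). intros t Ht.
    destruct (HT4 t Ht) as [i [l [Hl Hlt]]]. exists (i :: l). auto.
Qed.

Definition recurrent (G : list form) (D : nat -> list nat -> Prop)
    (L : nat -> list nat -> form -> Prop) (t : form) : Prop :=
  forall n, exists i l, n <= i /\ D i l /\ t = chi (L i l) G.

(* A limit of segments exits at the nearest world whose type is not recurrent. *)
Lemma segment_limit G k s D L :
  complete (s 0) -> (forall i, segment G k (s i) (D i) (L i) (s (S i))) ->
  exists out, segment G (S k) (s 0) (sum_dom D) (sum_lab L) out.
Proof.
  intros Hs0 H.
  assert (Hs : forall i, complete (s i)).
  { intros [|i]; [exact Hs0 | apply (seg_out _ _ _ _ _ _ (H i))]. }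
  destruct (classic (forall i, proper (s i))) as [Hpr|Hpr].
  - destruct (sublist_of_pred (chis G) (recurrent G D L)) as [T [HT HTrec]].
    (* From some stage [m] on only recurrent types occur, as each of the finitely many others stops
       occurring. *)
    destruct (eventually_all (chis G) (fun i t => forall l, D i l -> t = chi (L i l) G -> In t T))
      as [m Hm].
    { intros t Ht. destruct (classic (recurrent G D L t)) as [Hr|Hr].
      - exists 0. intros i _ l _ _. apply HTrec. auto.
      - apply not_all_ex_not in Hr. destruct Hr as [n Hn]. exists n.
        intros i Hi l Hl Heq. destruct Hn. eauto. }
    assert (HmT : forall i l, m <= i -> D i l -> In (chi (L i l) G) T).
    { intros i l Hi Hl. apply (Hm _ (in_chis (L i l) G) i Hi l Hl eq_refl). }
    assert (HTG : incl T (chis G)) by (intros t Ht; apply HTrec, Ht).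
    pose proof (none_of_decided G T HTG) as Hdec.
    (* [none_of T] fails at every world from stage [m] on, so these stages agree on its conditionals
       and the exit can be read off at [m]. *)
    assert (Hskip : forall i q, m <= i -> (s m (none_of T ▷ q)%form <-> s i (none_of T ▷ q)%form)).
    { intros i q Hi. apply (segments_pass G k s D L m i _ q H Hdec Hi).
      intros j x Hj Hx Hno. pose proof (seg_maximal _ _ _ _ _ _ (H j) x Hx) as Hmax.
      apply (none_of_not_In G T _ Hmax Hno). apply HmT; [lia|exact Hx]. }
    exists (sel (none_of T) (s m)). apply (segment_sum G k s D L); auto.
    + apply sel_complete. apply Hs.
    + intros i p q Hp Hno.
      rewrite (segments_pass G k s D L i (max i m) p q H Hp) by (lia || (intros; apply Hno; auto; lia)).
      (* The exit agrees with the one selected at stage [max i m], so [flatten] carries the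
         conditional over the limit: every recurrent type has a world past [i], where [p] fails. *)
      unfold sel. rewrite Hskip with (i := max i m) by lia.
      apply flatten; [apply Hs|]. apply (Imp_none_of G T p Hp).
      intros t Ht. apply HTrec in Ht. destruct Ht as [_ Ht].
      destruct (Ht i) as [j [l [Hj [Hl ->]]]]. exists (L j l).
      split; [apply (seg_maximal _ _ _ _ _ _ (H j) l Hl)|]. split; [reflexivity|]. eauto.
    + intros Ho. exists T. split; [exact HT|]. split; [|split].
      (* Segment [m] realises more than [k] types, and its exit starts the next segment with a type
         not listed in [U]. All of these lie in [T], which gives more than [k + 1]. *)
      * destruct (seg_types _ _ _ _ _ _ (H m) (Hpr (S m))) as [U [HU1 [HU2 [HU3 HU4]]]].
        apply Nat.lt_le_trans with (length (chi (s (S m)) G :: U)); [simpl; lia|].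
        apply NoDup_incl_length; [constructor; assumption|].
        intros t [<-|Ht].
        -- destruct (seg_start _ _ _ _ _ _ (H (S m)) (Hpr (S m))) as [l0 [Hl0 [<- _]]].
           apply HmT; [lia|exact Hl0].
        -- destruct (HU4 t Ht) as [l [Hl ->]]. apply HmT; auto.
      * apply none_of_not_In.
        -- split; [apply sel_complete, Hs | exact Ho].
        -- apply sel_self, Hs.
      * intros t Ht. apply HTrec in Ht. destruct Ht as [_ Ht].
        destruct (Ht 0) as [i [l [_ Hl]]]. eauto.
  (* After an improper theory all segments are empty: the chain has stopped, and the improper theory
     is the exit. *)
  - apply not_all_ex_not in Hpr. destruct Hpr as [n Hn].
    assert (Hafter : forall j, n <= j -> ~ proper (s j)).
    { intros j Hj. induction Hj as [|j Hj IH]; [exact Hn|].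
      apply (seg_empty _ _ _ _ _ _ (H j) IH). }
    exists (fun _ => True). apply (segment_sum G k s D L); auto.
    + split; auto.
    + intros _ [q Hq]. auto.
    + intros i p q Hp Hno.
      rewrite (segments_pass G k s D L i (max i n) p q H Hp) by (lia || (intros; apply Hno; auto; lia)).
      split; [auto|]. intros _. apply improper_all, Hafter. lia.
    + intros [q Hq]. tauto.
Qed.

Lemma segment_exists (G : list form) (k : nat) (w : form -> Prop) :
  complete w -> exists dom lab out, segment G k w dom lab out.
Proof.
  revert w. induction k as [|k IH]; intros w Hw; [apply segment_zero; exact Hw|].
  (* An incomplete [v] gets a dummy triple, so that a choice function is defined on all theories and
     can be iterated from [w]. *)
  assert (F : forall v, exists c : (list nat -> Prop) * (list nat -> form -> Prop) * (form -> Prop),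
             complete v -> segment G k v (fst (fst c)) (snd (fst c)) (snd c)).
  { intros v. destruct (classic (complete v)) as [Hv|Hv].
    - destruct (IH v Hv) as [D [L [o Ho]]]. exists (D, L, o). auto.
    - exists (fun _ => False, fun _ => v, v). tauto. }
  pose (c := fun v => proj1_sig (constructive_indefinite_description _ (F v))).
  assert (Hc : forall v, complete v -> segment G k v (fst (fst (c v))) (snd (fst (c v))) (snd (c v))).
  { intros v. exact (proj2_sig (constructive_indefinite_description _ (F v))). }
  pose (s := fix s n := match n with 0 => w | S n => snd (c (s n)) end).
  assert (Hs : forall n, complete (s n)).
  { induction n as [|n IHn]; [exact Hw|]. apply (seg_out _ _ _ _ _ _ (Hc _ IHn)). }
  destruct (segment_limit G k s (fun i => fst (fst (c (s i)))) (fun i => snd (fst (c (s i)))))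
    as [out Ho]; [apply Hs | intros i; apply Hc, Hs | eauto].
Qed.

(** At rank [length (chis G)] a proper exit would require more distinct types than there are. *)
Lemma complete_chain (G : list form) (w : form -> Prop) :
  complete w -> exists k dom lab out, segment G k w dom lab out /\ ~ proper out.
Proof.
  intros Hw. destruct (segment_exists G (length (chis G)) w Hw) as [dom [lab [out H]]].
  exists (length (chis G)), dom, lab, out. split; [exact H|]. intros Ho.
  destruct (seg_types _ _ _ _ _ _ H Ho) as [T [HT [Hlen [_ Hin]]]].
  assert (Hle : length T <= length (chis G)).
  { apply NoDup_incl_length; [exact HT|]. intros t Ht.
    destruct (Hin t Ht) as [l [_ ->]]. apply in_chis. }
  lia.
Qed.

(** * The chain as a linear order model *)

(** Lists outside [dom] become isolated worlds, so that no subset type is needed. *)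
Definition chain_prec (dom : list nat -> Prop) (x y : list nat) : Prop :=
  dom x /\ dom y /\ lexlt x y.

Definition chain_before (dom : list nat -> Prop) (w x y : list nat) : Prop :=
  (chain_prec dom w x \/ w = x) /\ chain_prec dom x y.

Lemma chain_prec_strict (dom : list nat -> Prop) : StrictOrder (chain_prec dom).
Proof.
  split.
  - intros x [_ [_ H]]. exact (lexlt_irrefl x H).
  - intros x y z [Hx [_ H]] [_ [Hz K]]. split; [exact Hx|]. split; [exact Hz|].
    exact (lexlt_trans x y z H K).
Qed.

Lemma chain_before_well_order (k : nat) (dom : list nat -> Prop) (w : list nat) :
  (forall l, dom l -> length l = k) ->
  exists E, strict_well_order_on E (chain_before dom w).
Proof.
  intros Hk. destruct (chain_prec_strict dom) as [Hirr Htr].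
  (* The field is the part of [dom] from [w] on, empty when [w] is outside [dom]. *)
  exists (fun x => dom w /\ dom x /\ (w = x \/ lexlt w x)). split.
  - intros x y [Hwx [Hx [Hy Hxy]]]. destruct Hwx as [[Hw [_ Hwx]]|<-].
    + repeat split; auto. right. eauto using lexlt_trans.
    + repeat split; auto.
  - split.
    + intros x [_ H]. exact (Hirr x H).
    + intros x y z [H1 H2] [H3 H4]. split; eauto.
  - intros x y [Hw [Hx Hwx]] [_ [Hy Hwy]].
    destruct (lexlt_total x y) as [H|[H|H]]; [rewrite (Hk x Hx), (Hk y Hy); auto| | auto |].
    + left. split; [|split; auto]. destruct Hwx; [auto|left; split; auto].
    + right; right. split; [|split; auto]. destruct Hwy; [auto|left; split; auto].
  - intros P HP Hex.
    destruct (lexlt_least k P) as [m [Hm Hmin]]; [|exact Hex|].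
    { intros l Hl. apply Hk. apply (HP l Hl). }
    exists m. split; [exact Hm|]. intros x Hx. destruct (Hmin x Hx) as [->|H]; [auto|right].
    destruct (HP m Hm) as [Hw [Hdm Hwm]]. destruct (HP x Hx) as [_ [Hdx _]].
    split; [|split; auto]. destruct Hwm; [auto|left; split; auto].
Qed.

Lemma chain_before_base (dom : list nat -> Prop) (w x y : list nat) :
  chain_before dom w x y -> w = x \/ chain_before dom w w x.
Proof. intros [[H|H] _]; [right; split|left]; auto. Qed.

Definition chain_frame (k : nat) (dom : list nat -> Prop)
    (Hk : forall l, dom l -> length l = k) : order_frame :=
  {| world := list nat; before := chain_before dom; world_nonempty := inhabits [];
     before_well_order := fun w => chain_before_well_order k dom w Hk;
     before_base := chain_before_base dom |}.

Definition chain_model (k : nat) (dom : list nat -> Prop) (lab : list nat -> form -> Prop)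
    (Hk : forall l, dom l -> length l = k) : order_model :=
  {| frame := chain_frame k dom Hk;
     valuation := fun a l => holds (lab l (Atom a)) |}.

Lemma chain_linear k dom lab Hk : linear (chain_model k dom lab Hk).
Proof.
  exists (chain_prec dom). split; [apply chain_prec_strict|].
  intros w x y. reflexivity.
Qed.

Fixpoint subforms (p : form) : list form :=
  p :: match p with
       | Atom _ => []
       | Neg p => subforms p
       | And p q | Cond p q => subforms p ++ subforms q
       end.

(** For conditionals, [seg_hit] applies at the nearest antecedent world; if there is none,
    [seg_miss] reduces the conditional to the improper [out], which contains it. *)
Lemma chain_truth G k w dom lab out
    (H : segment G k w dom lab out) (Hout : ~ proper out) (p : form) :
  incl (subforms p) G -> forall l, dom l ->
  (denot (chain_model k dom lab (seg_length _ _ _ _ _ _ H)) p l <-> lab l p).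
Proof.
  set (M := chain_model k dom lab (seg_length _ _ _ _ _ _ H)).
  (* Worlds in [dom] see only worlds in [dom], so the induction stays inside it. *)
  assert (Hacc : forall l x : list nat, dom l -> (@access M l x <-> dom x /\ (l = x \/ lexlt l x))).
  { intros l x Hl. unfold access. simpl. unfold chain_before, chain_prec.
    intuition (subst; auto). }
  assert (Hmax := seg_maximal _ _ _ _ _ _ H).
  induction p as [a|p IH|p IHp q IHq|p IHp q IHq]; intros HG l Hl.
  - apply holds_true.
  - simpl. rewrite IH, (maximal_Neg _ p (Hmax l Hl)); [tauto| |exact Hl].
    intros r Hr. apply HG. simpl; auto.
  - simpl. rewrite IHp, IHq, (complete_And _ p q (proj1 (Hmax l Hl))); try tauto;
      intros r Hr; apply HG; simpl; right; apply in_app_iff; auto.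
  - assert (HGp : incl (subforms p) G)
      by (intros r Hr; apply HG; simpl; right; apply in_app_iff; auto).
    assert (HGq : incl (subforms q) G)
      by (intros r Hr; apply HG; simpl; right; apply in_app_iff; auto).
    assert (Hp : decided G p).
    { intros u v _ _ Huv. apply (chi_agree u v G p Huv). apply HGp.
      destruct p; simpl; auto. }
    rewrite denot_Cond.
    destruct (classic (exists v, @access M l v /\ denot M p v)) as [Hex|Hno].
    + destruct (first_exists M l (denot M p) Hex) as [y Hy].
      assert (Hyq : lab l (p ▷ q)%form <-> lab y q).
      { destruct Hy as [Hly [Py Hmin]]. apply Hacc in Hly; [|exact Hl].
        destruct Hly as [Dy Hly].
        apply (seg_hit _ _ _ _ _ _ H l y p q Hp Hl Dy Hly); [apply IHp; auto|].
        intros x Dx Hlx Hxy Hxp. apply (Hmin x); [|apply IHp; auto].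
        split; [|split; auto]. destruct Hlx; [auto|left; split; auto]. }
      assert (Dy : dom y) by (apply (Hacc l y Hl), Hy).
      rewrite Hyq, <- (IHq HGq y Dy). split; [auto|].
      intros Hq z Hz. rewrite (first_unique M l _ z y Hz Hy). exact Hq.
    + split.
      * intros _. apply (seg_miss _ _ _ _ _ _ H l p q Hp Hl); [|apply improper_all, Hout].
        intros x Dx Hlx Hxp. apply Hno. exists x. split; [apply Hacc; auto|apply IHp; auto].
      * intros _ y [Hy [Py _]]. destruct Hno. eauto.
Qed.

Lemma C2F_complete (p : form) :
  (forall M : order_model, linear M -> forall w : M, denot M p w) -> C2F p.
Proof.
  intros Hval. apply C2F_of_maximal. intros w [Hw Hpr].
  destruct (complete_chain (subforms p) w Hw) as [k [dom [lab [out [H Hout]]]]].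
  destruct (seg_start _ _ _ _ _ _ H Hpr) as [l0 [Hl0 [<- _]]].
  apply (chain_truth _ _ _ _ _ _ H Hout p (incl_refl _) l0 Hl0).
  apply Hval. apply chain_linear.
Qed.

Theorem theorem4p5 :
  forall p : form,
    C2F p <->
    (forall M : order_model, linear M -> forall w : M, true_at M w p).
Proof.
  intros p. split.
  - exact (C2F_sound p).
  - exact (C2F_complete p).
Qed.
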